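(* Given $d\ge 2$ and $\varepsilon>0$, there exists $\gamma=\Omega\left(\dfrac{1}{d^{3/2}\log^3(d)}\cdot\dfrac{\varepsilon^2}{\log^2(1/\varepsilon)}\right)$ (with an absolute implied constant) such that the following holds for any field $\mathbb{F}$ and any sequence of matrices $M_1,\dots,M_k$ with $M_i\in\mathbb{F}^{d_i\times d_i}$ for some positive integers $d_i\le d$. Let $M=\bigotimes_{i=1}^k M_i$ and $n=\prod_{i=1}^k d_i$. If $n\ge d^{1/\gamma}$, then $R_{\mathbb{F}}(M,n^{1-\gamma})\le n^{1+\varepsilon}$.
   Context: For a field $\mathbb{F}$, a matrix $A\in\mathbb{F}^{n\times m}$ and a target rank $r\ge 0$, the rigidity $R_{\mathbb{F}}(A,r)$ is the minimum number of non-zero entries of a matrix $Z\in\mathbb{F}^{n\times m}$ such that $\operatorname{rank}(A-Z)\le r$. $\bigotimes$ denotes the Kronecker product.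
   Formalization: In the bound on γ, log(1/ε) is replaced by max(log 2, log(1/ε)): the printed bound is undefined at ε = 1 and false for ε just below 1 (it forces γ > 1, and all-ones matrices fail); for ε ≤ 1/2 it is the printed bound. *)

(* Defs.v *)
From mathcomp Require Import all_boot all_order all_algebra.
From mathcomp Require Import boolp reals interval_inference exp.
From mathcomp Require Import mxtens.

Set Implicit Arguments.
Unset Strict Implicit.
Unset Printing Implicit Defensive.

Import Order.TTheory GRing.Theory Num.Theory.
Local Open Scope ring_scope.

Definition nnz (F : fieldType) (m n : nat) (Z : 'M[F]_(m, n)) : nat :=
  #|[set ij : 'I_m * 'I_n | Z ij.1 ij.2 != 0]|.

(* The number s is attained by some Z bringing A down to rank at most r; the
   target rank r is real, since it is used at values such as n^(1 - gamma). *)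
Definition rigidity_cost (R : realType) (F : fieldType) (m n : nat)
    (A : 'M[F]_(m, n)) (r : {nonneg R}) (s : nat) : bool :=
  `[< exists Z : 'M[F]_(m, n), (\rank (A - Z)%R)%:R <= r%:num /\ nnz Z = s >].

Lemma rigidity_cost_ex (R : realType) (F : fieldType) (m n : nat)
    (A : 'M[F]_(m, n)) (r : {nonneg R}) : exists s, rigidity_cost A r s.
Proof.
by exists (nnz A); apply/asboolP; exists A; split=> //; rewrite subrr mxrank0; exact: ge0.
Qed.

Definition rigidity (R : realType) (F : fieldType) (m n : nat)
    (A : 'M[F]_(m, n)) (r : {nonneg R}) : nat :=
  ex_minn (rigidity_cost_ex A r).

Lemma prod_ord_recl (k : nat) (d : 'I_k.+1 -> nat) :
  (d ord0 * \prod_(i < k) d (lift ord0 i) = \prod_(i < k.+1) d i)%N.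
Proof. by rewrite big_ord_recl. Qed.

Lemma prod_ord0 (d : 'I_0 -> nat) : (1 = \prod_(i < 0) d i)%N.
Proof. by rewrite big_ord0. Qed.

(* M_0 (x) (M_1 (x) (... (x) M_(k-1))), with value the 1 x 1 identity matrix for
   k = 0; the casts only rewrite the dimension as a big product. *)
Fixpoint kronecker (F : fieldType) (k : nat) :
    forall (d : 'I_k -> nat) (M : forall i, 'M[F]_(d i)),
      'M[F]_(\prod_(i < k) d i) :=
  match k with
  | 0 => fun d _ => castmx (prod_ord0 d, prod_ord0 d) 1%:M
  | k'.+1 => fun d M =>
      castmx (prod_ord_recl d, prod_ord_recl d)
        (M ord0 *t kronecker (fun i => M (lift ord0 i)))
  end.

(* log(1/eps), kept at least log 2: for eps <= 1/2 it is ln (1 / eps). Near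
   eps = 1 the factor eps^2 / log^2(1/eps) would be unbounded, whereas gamma
   cannot exceed 1 when eps < 1 (consider all-ones matrices). *)
Definition log_inv (R : realType) (eps : R) : R :=
  Num.max (ln 2) (ln (1 / eps)).

(* Main.v *)
Require Import Defs.
From mathcomp Require Import all_boot all_order all_algebra all_fingroup.
From mathcomp Require Import boolp reals interval_inference exp.
From mathcomp Require Import sequences mxtens ring lra zify.

Set Implicit Arguments.
Unset Strict Implicit.
Unset Printing Implicit Defensive.

Import Order.TTheory GRing.Theory Num.Theory.
Local Open Scope ring_scope.

(** Write each [M_i] as [P L U] and split [L] and [U] into matrices that differ
    from the identity in a single column; then [M] is a permutation matrix times
    [2 d] Kronecker products of such one-column matrices.  In the product for
    column [j], an entry [(x, y)] is nonzero only if [y_i = j] wherever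
    [x_i <> y_i], so [x] and [y] differ in exactly [N y - N x] coordinates, where
    [N] counts the coordinates equal to [j].  By a Chernoff bound, all but few
    rows and columns have [N] close to its mean; deleting the exceptional ones
    costs little rank and leaves few nonzero entries in each row.  Row sparsity is
    submultiplicative and the rank of the error subadditive under products.  The
    expected values of [N], summed over [j], give at most [k], which keeps the
    total cost of the [2 d] factors under control. *)

(** * Rank of matrices supported on few rows or columns *)

Lemma mxrank_sum (F : fieldType) (I : finType) (P : pred I) m n
    (B : I -> 'M[F]_(m, n)) :
  (\rank (\sum_(i | P i) B i)%R <= \sum_(i | P i) \rank (B i))%N.
Proof.
elim/big_ind2: _ => [|A a C c hA hC|//]; first by rewrite mxrank0.
exact: leq_trans (mxrank_add _ _) (leq_add hA hC).
Qed.

Lemma mxrank_row_support (F : fieldType) m n (A : 'M[F]_(m, n)) (S : {set 'I_m}) :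
  (forall x y, x \notin S -> A x y = 0) -> (\rank A <= #|S|)%N.
Proof.
move=> A0; have -> : A = \sum_(x in S) (delta_mx x ord0 : 'cV_m) *m row x A.
  apply/matrixP => x y; rewrite summxE.
  have E z : ((delta_mx z ord0 : 'cV_m) *m row z A) x y = (x == z)%:R * A z y.
    by rewrite !mxE big_ord1 !mxE eqxx andbT.
  under eq_bigr do rewrite E.
  have [xS|xS] := boolP (x \in S).
    rewrite (bigD1 x) //= eqxx mul1r big1 ?addr0 // => z /andP[_ /negbTE zx].
    by rewrite eq_sym zx mul0r.
  rewrite big1 ?A0 // => z zS; case: eqP => [xz|]; last by rewrite mul0r.
  by rewrite xz zS in xS.
apply: leq_trans (mxrank_sum _ _) _; rewrite -sum1_card leq_sum // => x _.
by rewrite (leq_trans (mxrankM_maxl _ _)) // rank_leq_col.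
Qed.

Lemma mxrank_col_support (F : fieldType) m n (A : 'M[F]_(m, n)) (S : {set 'I_n}) :
  (forall x y, y \notin S -> A x y = 0) -> (\rank A <= #|S|)%N.
Proof.
move=> A0; rewrite -mxrank_tr; apply: mxrank_row_support => y x yS.
by rewrite mxE A0.
Qed.

(** * Sparse approximations, and exponential-moment profiles of Kronecker products *)

Definition sparse_approx (R : realType) (F : fieldType) n (A : 'M[F]_n)
    (r s : R) :=
  exists Z : 'M[F]_n, (\rank (A - Z)%R)%:R <= r /\
    forall x, #|[set y | Z x y != 0]|%:R <= s.

(** Writing [A B - Y Z = (A - Y) B + Y (B - Z)] makes the error ranks add. A row of [Y Z] is a
    combination of at most [s1] rows of [Z], each with at most [s2] nonzero entries. *)
Lemma sparse_approx_mul (R : realType) (F : fieldType) n (A B : 'M[F]_n)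
    (r1 s1 r2 s2 : R) :
  sparse_approx A r1 s1 -> sparse_approx B r2 s2 ->
  sparse_approx (A *m B) (r1 + r2) (s1 * s2).
Proof.
move=> [Y [rY sY]] [Z [rZ sZ]]; exists (Y *m Z); split.
  have -> : A *m B - Y *m Z = (A - Y) *m B + Y *m (B - Z).
    by rewrite mulmxBl mulmxBr addrA subrK.
  apply: le_trans (lerD rY rZ); rewrite -natrD ler_nat.
  apply: leq_trans (mxrank_add _ _) _.
  by rewrite leq_add ?mxrankM_maxl ?mxrankM_maxr.
move=> x; set S := [set z | Y x z != 0].
have sub : [set y | (Y *m Z) x y != 0] \subset
    \bigcup_(z in S) [set y | Z z y != 0].
  apply/subsetP => y; rewrite inE mxE => nz.
  have [z /andP[Yz Zz]|allz] := pickP [pred z | (Y x z != 0) && (Z z y != 0)].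
    by apply/bigcupP; exists z; rewrite inE.
  case/eqP: nz; apply: big1 => z _; move: (allz z) => /= /negbT.
  by rewrite negb_and !negbK => /orP[] /eqP ->; rewrite ?mul0r ?mulr0.
have card_cup : (#|\bigcup_(z in S) [set y | Z z y != 0%R]| <=
    \sum_(z in S) #|[set y | Z z y != 0%R]|)%N.
  elim/big_ind2: _ => [|U a V c hU hV|//]; first by rewrite cards0.
  by rewrite (leq_trans (leq_card_setU _ _)) ?leq_add.
apply: (@le_trans _ _ (\sum_(z in S) s2)).
  apply: (@le_trans _ _ (\sum_(z in S) #|[set y | Z z y != 0%R]|)%N%:R).
    by rewrite ler_nat (leq_trans (subset_leq_card sub)).
  by rewrite natr_sum; apply: ler_sum.
rewrite sumr_const -[_ *+ _]mulr_natl ler_wpM2r ?sY //.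
exact: le_trans (sZ x).
Qed.

(* In the application [N] is the centred number of coordinates equal to [j], and
   [N y - N x] is the number of coordinates where [x] and [y] differ. *)
Definition profile (R : realType) (F : fieldType) n (A : 'M[F]_n)
    (la th a K : R) :=
  exists N : 'I_n -> R,
    [/\ \sum_x expR (la * N x) <= a,
        \sum_x expR (- la * N x) <= a &
        forall x, \sum_(y | A x y != 0) expR (th * (N x - N y)) <= K].

Lemma profile_cast (R : realType) (F : fieldType) m n (e : m = n) (A : 'M[F]_m)
    (la th a K : R) :
  profile A la th a K -> profile (castmx (e, e) A) la th a K.
Proof. by case: n / e; rewrite castmx_id. Qed.

(** The sum of the two potentials serves for the product: each of the three exponential sums then
    factors over the two coordinates. *)
Lemma profile_tens (R : realType) (F : fieldType) m n (A : 'M[F]_m)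
    (B : 'M[F]_n) (la th a K b L : R) :
  profile A la th a K -> profile B la th b L ->
  profile (A *t B) la th (a * b) (K * L).
Proof.
move=> [N [Na Na' NK]] [P [Pb Pb' PL]].
pose Q (x : 'I_(m * n)) := N (mxtens_unindex x).1 + P (mxtens_unindex x).2.
have sumQ t : \sum_x expR (t * Q x) =
    (\sum_x expR (t * N x)) * (\sum_x expR (t * P x)).
  by rewrite mulr_sum; apply: eq_bigr => x _; rewrite mulrDr expRD.
exists Q; split.
- by rewrite sumQ ler_pM // sumr_ge0 // => *; exact: expR_ge0.
- by rewrite sumQ ler_pM // sumr_ge0 // => *; exact: expR_ge0.
move=> x; set x1 := (mxtens_unindex x).1; set x2 := (mxtens_unindex x).2.
apply: le_trans (ler_pM _ _ (NK x1) (PL x2)); last 2 first.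
- by rewrite sumr_ge0 // => *; exact: expR_ge0.
- by rewrite sumr_ge0 // => *; exact: expR_ge0.
rewrite [X in X * _]big_mkcond [X in _ * X]big_mkcond /= mulr_sum big_mkcond /=.
apply: ler_sum => y _; rewrite mxE mulf_eq0 negb_or.
have -> : th * (Q x - Q y) = th * (N x1 - N (mxtens_unindex y).1) +
  th * (P x2 - P (mxtens_unindex y).2) by rewrite /Q; ring.
case: eqP => _ /=; first by rewrite mul0r.
by case: eqP => _ /=; rewrite ?mulr0 // expRD.
Qed.

Lemma profile_kronecker (R : realType) (F : fieldType) k (d : 'I_k -> nat)
    (M : forall i, 'M[F]_(d i)) (la th : R) (a K : 'I_k -> R) :
  (forall i, profile (M i) la th (a i) (K i)) ->
  profile (kronecker M) la th (\prod_i a i) (\prod_i K i).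
Proof.
elim: k d M a K => [|k IH] d M a K prof /=.
  apply: profile_cast; rewrite !big_ord0; exists (fun=> 0); split.
  - by rewrite big_ord1 mulr0 expR0.
  - by rewrite big_ord1 mulr0 expR0.
  move=> x; rewrite (eq_bigl predT) ?big_ord1 ?subrr ?mulr0 ?expR0 // => y.
  by rewrite [x]ord1 [y]ord1 mxE oner_neq0.
apply: profile_cast; rewrite !big_ord_recl.
by apply: profile_tens => //; apply: (IH (fun i => d (lift ord0 i))).
Qed.

Lemma castmx_mul_square (F : fieldType) m n (e : m = n) (A B : 'M[F]_m) :
  castmx (e, e) (A *m B) = castmx (e, e) A *m castmx (e, e) B.
Proof. by case: n / e; rewrite !castmx_id. Qed.

Lemma kronecker_mul (F : fieldType) k (d : 'I_k -> nat)
    (A B : forall i, 'M[F]_(d i)) :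
  kronecker (fun i => A i *m B i) = kronecker A *m kronecker B.
Proof.
elim: k d A B => [|k IH] d A B /=.
  by rewrite -castmx_mul_square mulmx1.
rewrite (IH (fun i => d (lift ord0 i)) (fun i => A (lift ord0 i))).
by rewrite -castmx_mul_square tensmx_mul.
Qed.

(* Rows with [N < - De] and columns with [N > De] are few by the exponential
   moments, so they contribute a matrix of small rank. *)
Lemma profile_approx (R : realType) (F : fieldType) n (A : 'M[F]_n)
    (la th a K De : R) : 0 <= la -> 0 <= th ->
  profile A la th a K ->
  sparse_approx A (2 * (a * expR (- (la * De)))) (expR (2 * th * De) * K).
Proof.
move=> la0 th0 [N [Na Na' NK]].
pose good x y := (- De <= N x) && (N y <= De).
exists (\matrix_(x, y) if good x y then A x y else 0); split; last first.
  (* A kept entry has [N x - N y >= - 2 De], so scaling by [expR (2 th De)] gives it weight at least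
     1, and the weighted sum bounds the count. *)
  move=> x; apply: le_trans (ler_wpM2l (expR_ge0 _) (NK x)).
  rewrite mulr_sumr -sum1_card natr_sum big_mkcond [leRHS]big_mkcond /=.
  apply: ler_sum => y _; rewrite inE mxE.
  have [/andP[xD yD]|_] := boolP (good x y); last first.
    by rewrite eqxx; case: ifP => // _; rewrite mulr_ge0 ?expR_ge0.
  case: ifP => // _; rewrite -expRD -[leLHS]expR0 ler_expR.
  have -> : 2 * th * De + th * (N x - N y) = th * ((N x + De) + (De - N y)).
    by ring.
  by apply: mulr_ge0 => //; lra.
have markov (t : R) (S : {set 'I_n}) : \sum_x expR (t * N x) <= a ->
    (forall x, x \in S -> la * De <= t * N x) ->
    #|S|%:R <= a * expR (- (la * De)).
  move=> Sa hS; apply: le_trans (ler_wpM2r (expR_ge0 _) Sa).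
  rewrite mulr_suml -sum1_card natr_sum big_mkcond /=.
  apply: ler_sum => y _; case: ifP => [yS|_]; last first.
    by rewrite mulr_ge0 ?expR_ge0.
  rewrite -expRD -[leLHS]expR0 ler_expR.
  by have := hS _ yS; lra.
set S1 := [set x | N x < - De]; set S2 := [set y | De < N y].
have h1 : #|S1|%:R <= a * expR (- (la * De)).
  apply: (markov (- la)) => // x; rewrite inE => xS.
  have := ler_wpM2l la0 (ltW xS); lra.
have h2 : #|S2|%:R <= a * expR (- (la * De)).
  apply: (markov la) => // x; rewrite inE => xS.
  exact: (ler_wpM2l la0 (ltW xS)).
have -> : 2 * (a * expR (- (la * De))) =
  a * expR (- (la * De)) + a * expR (- (la * De)) by ring.
apply: le_trans (lerD h1 h2); rewrite -natrD ler_nat.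
pose B1 : 'M[F]_n := \matrix_(x, y) if x \in S1 then A x y else 0.
pose B2 : 'M[F]_n := \matrix_(x, y) if (x \notin S1) && (y \in S2) then A x y else 0.
have -> : A - (\matrix_(x, y) (if good x y then A x y else 0))%R = B1 + B2.
  apply/matrixP => x y; rewrite !mxE /good !inE !ltNge.
  by case: (_ <= _); case: (_ <= _); rewrite /= ?subrr ?subr0 ?addr0 ?add0r.
apply: leq_trans (mxrank_add _ _) (leq_add _ _).
  by apply: mxrank_row_support => x y /negbTE xS; rewrite mxE xS.
by apply: mxrank_col_support => x y /negbTE xS; rewrite mxE xS andbF.
Qed.

(** * Profiles of one-column matrices *)

Lemma expR_le_quadratic (R : realType) (u : R) :
  u <= 1 / 2 -> expR u <= 1 + u + 2 * u ^+ 2.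
Proof.
move=> u2; have h := expR_ge1Dx (- u); rewrite expRN in h.
have u1 : 0 < 1 - u by lra.
have e : expR u <= (1 - u)^-1.
  by rewrite -[expR u]invrK lef_pV2 ?posrE ?invr_gt0 ?expR_gt0.
apply: le_trans e _; rewrite -[leLHS]mul1r ler_pdivrMr //.
have := mulr_ge0 (sqr_ge0 u) (_ : 0 <= 1 - 2 * u); rewrite expr2; nra.
Qed.

(** Only the support matters, so the diagonal is left free. The natural number [j] is shared by
    factors of different sizes; for [j >= m] the matrix is diagonal. *)
Definition column_matrix (F : fieldType) m (j : nat) (A : 'M[F]_m) :=
  forall x y : 'I_m, A x y != 0 -> x = y \/ y = j :> nat.

(** Centring the indicator of [j] at its mean [1 / m] removes the first-order term in [la]. A row
    has weight at most 1 on the diagonal and [expR (- th)] in column [j], and [1 + v <= expR v].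
    Diagonal matrices get the zero potential, so that factors of size 1, whose number [n] does not
    control, cost nothing. *)
Lemma profile_column_matrix (R : realType) (F : fieldType) m (j : nat)
    (A : 'M[F]_m) (la th : R) : (0 < m)%N -> `|la| <= 1 / 2 ->
  column_matrix j A ->
  profile A la th (m%:R * expR (2 * la ^+ 2 * (((1 < m) && (j < m))%N%:R / m%:R)))
    (expR ((1 < m)%N%:R * expR (- th))).
Proof.
move=> m0 la2 colA; have m0R : 0 < m%:R :> R by rewrite ltr0n.
have [/andP[m1 jm]|/negbTE nact] := boolP ((1 < m) && (j < m))%N; last first.
  exists (fun=> 0); split.
  - by rewrite mulr0 expR0 mul0r mulr0 expR0 mulr1 sumr_const card_ord.
  - by rewrite mulr0 expR0 mul0r mulr0 expR0 mulr1 sumr_const card_ord.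
  move=> x; apply: (@le_trans _ _ (\sum_(y | y == x) 1)).
    rewrite big_mkcond [leRHS]big_mkcond; apply: ler_sum => y _.
    case: ifP => [/colA [->|yj]|_]; last by case: ifP.
      by rewrite eqxx subrr mulr0 expR0.
    have jm : (j < m)%N by rewrite -yj.
    move: nact; rewrite jm andbT => m1.
    have /eqP -> : y == x.
      by apply/eqP/val_inj; move: (ltn_ord x) (ltn_ord y) => /=; lia.
    by rewrite eqxx subrr mulr0 expR0.
  by rewrite big_pred1_eq -[leLHS]expR0 ler_expR mulr_ge0 ?expR_ge0.
pose J := Ordinal jm.
exists (fun x => (x == J)%:R - m%:R^-1).
have moment (t : R) : `|t| <= 1 / 2 ->
    \sum_x expR (t * ((x == J)%:R - m%:R^-1)) <=
    m%:R * expR (2 * t ^+ 2 * (1 / m%:R)).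
  rewrite ler_norml => /andP[_ t2].
  rewrite (bigD1 J) //= eqxx (eq_bigr (fun=> expR (- (t / m%:R)))); last first.
    by move=> x /negbTE ->; rewrite sub0r mulrN.
  rewrite sumr_const cardC1 card_ord -[_ *+ m.-1]mulr_natl.
  have -> : (m.-1)%:R = m%:R - 1 :> R by rewrite -subn1 natrB.
  rewrite mulrBr mulr1 expRD -mulrDl.
  (* What remains is [expR t + m - 1 <= m expR ((t + 2 t^2) / m)]. *)
  have -> : 2 * t ^+ 2 * (1 / m%:R) = (t + 2 * t ^+ 2) / m%:R + - (t / m%:R).
    by field; rewrite gt_eqF.
  rewrite expRD mulrA ler_wpM2r ?expR_ge0 //.
  apply: le_trans (ler_wpM2l (ltW m0R) (expR_ge1Dx _)).
  rewrite mulrDr mulr1 mulrCA divff ?gt_eqF // mulr1.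
  by have := expR_le_quadratic t2; lra.
split.
- exact: moment.
- by rewrite -[la ^+ 2]sqrrN; apply: moment; rewrite normrN.
move=> x; rewrite m1 mul1r; apply: le_trans (expR_ge1Dx _).
apply: (@le_trans _ _ (\sum_y ((y == x)%:R + (y == J)%:R * expR (- th)))).
  rewrite big_mkcond; apply: ler_sum => y _.
  have nn : 0 <= (y == x)%:R + (y == J)%:R * expR (- th).
    by rewrite addr_ge0 // mulr_ge0 ?expR_ge0.
  case: ifP => // /colA; have [->|yx] := eqVneq y x.
    move=> _; rewrite subrr mulr0 expR0 lerDl mulr_ge0 ?expR_ge0 //.
  case=> [xy|yj]; first by rewrite xy eqxx in yx.
  have yJ : y = J by apply: val_inj.
  rewrite yJ eqxx mul1r add0r ler_expR eq_sym -yJ eq_sym.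
  rewrite [x == y]eq_sym (negbTE yx) /=; lra.
have sum1 (z : 'I_m) : \sum_y (y == z)%:R = 1 :> R.
  by rewrite (bigD1 z) //= eqxx big1 ?addr0 // => y /negbTE ->.
by rewrite big_split /= -mulr_suml !sum1 mul1r.
Qed.

(** * Factorization into one-column matrices *)

Definition cols_from (F : fieldType) m (S : pred nat) (A : 'M[F]_m) : 'M[F]_m :=
  \matrix_(x, y) if S y then A x y else (x == y)%:R.

Lemma column_matrix_cols_from (F : fieldType) m (t : nat) (A : 'M[F]_m) :
  column_matrix t (cols_from (pred1 t) A).
Proof.
move=> x y; rewrite mxE /=; have [yt _|_] := eqVneq (y : nat) t; first by right.
by have [->|_] := eqVneq x y; [left | rewrite eqxx].
Qed.

(** Column [t] of [A] vanishes at the indices in [S], and the left factor has unit vectors as its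
    columns outside [S], so it fixes that column. The other columns of the right factor are unit
    vectors and copy those of the left factor. *)
Lemma cols_from_mul (F : fieldType) m (S : pred nat) (t : nat) (A : 'M[F]_m) :
  (forall z y : 'I_m, S z -> y = t :> nat -> A z y = 0) ->
  cols_from S A *m cols_from (pred1 t) A = cols_from (predU (pred1 t) S) A.
Proof.
move=> A0; apply/matrixP => x y; rewrite !mxE /=.
have [yt|yt] := eqVneq (y : nat) t => /=.
  rewrite (bigD1 x) //= big1 ?addr0 => [|z zx]; rewrite !mxE /= yt !eqxx.
    case: ifP => Sx; last by rewrite mul1r.
    by rewrite (A0 x y Sx yt) mulr0.
  case: ifP => Sz; first by rewrite (A0 z y Sz yt) mulr0.
  by rewrite eq_sym (negbTE zx) mul0r.
rewrite (bigD1 y) //= big1 ?addr0 => [|z zy]; rewrite !mxE /= (negbTE yt).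
  by rewrite eqxx mulr1.
by rewrite (negbTE zy) mulr0.
Qed.

Lemma eq_cols_from (F : fieldType) m (S S' : pred nat) (A : 'M[F]_m) :
  (forall y, (y < m)%N -> S y = S' y) -> cols_from S A = cols_from S' A.
Proof. by move=> eS; apply/matrixP => x y; rewrite !mxE eS. Qed.

Lemma cols_from0 (F : fieldType) m (S : pred nat) (A : 'M[F]_m) :
  (forall y, (y < m)%N -> S y = false) -> cols_from S A = 1%:M.
Proof. by move=> eS; apply/matrixP => x y; rewrite !mxE eS. Qed.

Lemma cols_fromT (F : fieldType) m (S : pred nat) (A : 'M[F]_m) :
  (forall y, (y < m)%N -> S y) -> cols_from S A = A.
Proof. by move=> eS; apply/matrixP => x y; rewrite !mxE eS. Qed.

(** The column treated by factor number [l]: upwards for [L], then downwards for [U], so each index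
    below [d] occurs twice among [l < 2 d]. *)
Definition sweep d l := (if l < d then l else (2 * d).-1 - l)%N.

(* In [M = P L U], a unit lower triangular [L] is the product of its columns
   taken from left to right, and [U] that of its columns from right to left. *)
Lemma column_factorization (F : fieldType) d m (M : 'M[F]_m) :
  (0 < m <= d)%N ->
  exists gf : (nat -> 'M[F]_m) * (nat -> 'M[F]_m),
    [/\ is_perm_mx (gf.1 0%N),
        forall l, (l < 2 * d)%N -> gf.1 l.+1 = gf.1 l *m gf.2 l,
        forall l, column_matrix (sweep d l) (gf.2 l) &
        gf.1 (2 * d)%N = M].
Proof.
case: m M => // m M; rewrite ltnS /= => md.
have := cormen_lup_correct M; have := cormen_lup_perm M.
have := @cormen_lup_lower _ m M; have := @cormen_lup_upper _ m M.
case: cormen_lup => [[P L] U] /= Up Lo /is_perm_mxP[s ->] PM.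
pose Q : 'M[F]_m.+1 := perm_mx s^-1.
have MQ : M = Q *m (L *m U).
  by rewrite /Q [L *m U](esym PM) mulmxA -perm_mxM mulVg perm_mx1 mul1mx.
(* Partial products. When the size is below [d], factors whose column lies outside the matrix are
   identities, so all [M_i] share the length [2 d]. *)
pose g l := Q *m if (l <= d)%N then cols_from (fun y => y < l)%N L
                 else L *m cols_from (fun y => 2 * d - l <= y)%N U.
have gE l : (d <= l)%N ->
    g l = Q *m (L *m cols_from (fun y => 2 * d - l <= y)%N U).
  rewrite /g leq_eqVlt => /orP[/eqP <-|]; last by rewrite ltnNge => /negbTE ->.
  rewrite leqnn cols_fromT => [|y ym]; last by lia.
  by rewrite cols_from0 ?mulmx1 // => y ym; lia.
pose f l := if (l < d)%N then cols_from (pred1 (sweep d l)) L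
            else cols_from (pred1 (sweep d l)) U.
exists (g, f); split => /=.
- by rewrite /g /= cols_from0 // mulmx1 perm_mx_is_perm.
- move=> l l2; have [ld|dl] := ltnP l d.
    rewrite /g ld (ltnW ld) /f /sweep ld -mulmxA cols_from_mul.
      by congr (_ *m _); apply: eq_cols_from => y _ /=; lia.
    move=> z y zl yl; rewrite Lo; last by lia.
    by case: eqP => // zy; move: zl; rewrite zy yl ltnn.
  rewrite !gE ?(leqW dl) // /f /sweep ltnNge dl /= -!mulmxA cols_from_mul.
    by congr (_ *m (_ *m _)); apply: eq_cols_from => y ym /=; lia.
  by move=> z y zl yl; rewrite Up //; lia.
- by move=> l; rewrite /f; case: ifP => _; exact: column_matrix_cols_from.
by rewrite gE ?leq_pmull // cols_fromT // => y _; rewrite subnn.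
Qed.

(** * Approximation of the whole Kronecker product *)

Lemma profile_perm_mx (R : realType) (F : fieldType) m (A : 'M[F]_m) :
  is_perm_mx A -> profile A 0 0 (m%:R : R) 1.
Proof.
case/is_perm_mxP => s ->; exists (fun=> 0); split.
- by rewrite mulr0 expR0 sumr_const card_ord.
- by rewrite mulr0 expR0 sumr_const card_ord.
move=> x; rewrite mul0r expR0 (eq_bigl (pred1 (s x))) ?big_pred1_eq // => y.
by rewrite !mxE /= [y == _]eq_sym; case: (s x == y); rewrite ?oner_neq0 ?eqxx.
Qed.

(** At zero parameters a profile bounds just the row sparsity, and the matrix approximates
    itself. *)
Lemma profile0_approx (R : realType) (F : fieldType) n (A : 'M[F]_n) (a K : R) :
  profile A 0 0 a K -> sparse_approx A 0 K.
Proof.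
move=> [N [_ _ NK]]; exists A; split; first by rewrite subrr mxrank0.
move=> x; apply: le_trans (NK x); rewrite -sum1_card natr_sum.
rewrite (eq_bigl (fun y => A x y != 0)) => [|y]; last by rewrite inE.
by apply: ler_sum => y _; rewrite mul0r expR0.
Qed.

(** The mean number of coordinates equal to [j] in a uniform index, over the factors of size above
    1. *)
Definition density (R : realType) k (d_ : 'I_k -> nat) (j : nat) : R :=
  \sum_i ((1 < d_ i) && (j < d_ i))%N%:R / (d_ i)%:R.

Lemma kronecker_column_approx (R : realType) (F : fieldType) k
    (d_ : 'I_k -> nat) (C : forall i, 'M[F]_(d_ i)) (j : nat) (la th T : R) :
  0 < la <= 1 / 2 -> 0 <= th -> (forall i, 0 < d_ i)%N ->
  (forall i, column_matrix j (C i)) ->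
  sparse_approx (kronecker C) (2 * ((\prod_i d_ i)%N%:R * expR (- T)))
    (expR (2 * th * T / la + (\sum_i (1 < d_ i)%N)%N%:R * expR (- th)
           + 4 * th * la * density R d_ j)).
Proof.
move=> /andP[la0 la2] th0 d0 colC; set mu := density R d_ j.
have nla : `|la| <= 1 / 2 by rewrite ger0_norm // ltW.
have prof := profile_kronecker
  (fun i => profile_column_matrix th (d0 i) nla (colC i)).
(* This deviation cancels the moment factor [expR (2 la^2 mu)] and leaves exactly [expR (- T)] in
   the rank. *)
have := @profile_approx R F _ _ la th _ _ (T / la + 2 * la * mu) (ltW la0) th0 prof.
rewrite big_split /= -natr_prod -!expR_sum -mulr_sumr -mulr_suml -natr_sum.
congr sparse_approx; last by rewrite -expRD; congr expR; ring.
congr (_ * _); rewrite -[LHS]mulrA -expRD; congr (_ * expR _).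
by rewrite -[\sum_(i < k) _]/mu; field; rewrite gt_eqF.
Qed.

(** A factor of size [m > 1] contributes [1 / m] to each of [m] columns. *)
Lemma sum_density (R : realType) k (d_ : 'I_k -> nat) d :
  (forall i, 0 < d_ i <= d)%N ->
  \sum_(0 <= j < d) density R d_ j = (\sum_i (1 < d_ i)%N)%N%:R.
Proof.
move=> dd; rewrite /density exchange_big natr_sum; apply: eq_bigr => i _ /=.
case: (ltnP 1 (d_ i)) => d1 /=; last by rewrite big1 // => *; rewrite mul0r.
have /andP[d0 did] := dd i.
rewrite -mulr_suml -natr_sum.
suff -> : (\sum_(0 <= j < d) (j < d_ i) = d_ i)%N.
  by rewrite divff // pnatr_eq0 -lt0n.
rewrite -[LHS]big_mkcond /= -(big_nat_widen 0 (d_ i) d predT) //.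
by rewrite sum_nat_const_nat subn0 muln1.
Qed.

Lemma sum_sweep (V : nmodType) (f : nat -> V) d :
  \sum_(0 <= l < 2 * d) f (sweep d l) = (\sum_(0 <= j < d) f j) *+ 2.
Proof.
rewrite (big_cat_nat (n := d)) //=; last by rewrite leq_pmull.
rewrite mulr2n; congr (_ + _).
  by apply: eq_big_nat => l /andP[_ ld]; rewrite /sweep ld.
rewrite -{1}[d]add0n big_addn mul2n -addnn addnK [RHS]big_nat_rev /=.
apply: eq_big_nat => l ld; congr f; rewrite /sweep; case: ifP; lia.
Qed.

Lemma kronecker_approx (R : realType) (F : fieldType) k d (d_ : 'I_k -> nat)
    (M : forall i, 'M[F]_(d_ i)) (la th T : R) :
  0 < la <= 1 / 2 -> 0 <= th -> (forall i, 0 < d_ i <= d)%N ->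
  let k' := (\sum_i (1 < d_ i)%N)%N%:R in
  sparse_approx (kronecker M)
    ((2 * d)%:R * (2 * ((\prod_i d_ i)%N%:R * expR (- T))))
    (expR ((2 * d)%:R * (2 * th * T / la + k' * expR (- th))
           + 8 * th * la * k')).
Proof.
move=> hla th0 dd k'.
pose gf i := projT1 (cid (column_factorization (M i) (dd i))).
have hgf i := projT2 (cid (column_factorization (M i) (dd i))).
pose g l i := (gf i).1 l; pose f l i := (gf i).2 l.
have d0 i : (0 < d_ i)%N by have /andP[] := dd i.
(* Induction on partial products, starting from a permutation matrix. The densities are kept as a
   sum along the sweep, which totals [2 k'] at the end. *)
have step l : (l <= 2 * d)%N -> sparse_approx (kronecker (g l))
    (l%:R * (2 * ((\prod_i d_ i)%N%:R * expR (- T))))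
    (expR (l%:R * (2 * th * T / la + k' * expR (- th))
           + 4 * th * la * \sum_(0 <= t < l) density R d_ (sweep d t))).
  elim: l => [_|l IH ld].
    rewrite !mul0r big_nil mulr0 addr0 expR0.
    have := profile_kronecker
      (fun i => profile_perm_mx R (let: And4 p _ _ _ := hgf i in p)).
    by move/profile0_approx; rewrite [\prod_i (1 : R)]big1_eq.
  have -> : kronecker (g l.+1) = kronecker (g l) *m kronecker (f l).
    rewrite -kronecker_mul; congr kronecker.
    apply: functional_extensionality_dep => i.
    by have [_ + _ _] := hgf i; apply.
  have colf i : column_matrix (sweep d l) (f l i) by have [_ _ + _] := hgf i; apply.
  have := sparse_approx_mul (IH (ltnW ld))
    (kronecker_column_approx T hla th0 d0 colf).
  congr sparse_approx; first by rewrite -[l.+1]addn1 natrD; ring.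
  rewrite -expRD big_nat_recr //= -[l.+1]addn1 natrD; congr expR; rewrite -/k'.
  by ring.
have := step _ (leqnn _); rewrite (sum_sweep (density R d_)) sum_density // -/k'.
have -> : g (2 * d)%N = M.
  by apply: functional_extensionality_dep => i; have [_ _ _] := hgf i.
congr (sparse_approx _ _ (expR (_ + _))).
by rewrite -mulr_natr; ring.
Qed.

(** * From row sparsity to rigidity, and logarithmic estimates *)

Lemma rigidity_le (R : realType) (F : fieldType) n (A : 'M[F]_n)
    (r : {nonneg R}) (Z : 'M[F]_n) :
  (\rank (A - Z)%R)%:R <= r%:num -> (rigidity A r <= nnz Z)%N.
Proof.
rewrite /rigidity => rZ; case: ex_minnP => s _; apply.
by apply/asboolP; exists Z.
Qed.

Lemma nnz_row_sparse (R : realType) (F : fieldType) n (Z : 'M[F]_n) (s : R) :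
  (forall x, #|[set y | Z x y != 0]|%:R <= s) -> (nnz Z)%:R <= n%:R * s.
Proof.
move=> sZ; rewrite /nnz -sum1_card.
rewrite (eq_bigl (fun p : 'I_n * 'I_n => true && (Z p.1 p.2 != 0))); last first.
  by move=> p; rewrite inE.
rewrite -(pair_big_dep predT (fun x y => Z x y != 0) (fun _ _ => 1%N)) /=.
rewrite natr_sum -[n in n%:R * s]card_ord mulr_natl -sumr_const.
apply: ler_sum => x _; apply: le_trans (sZ x).
by rewrite -sum1_card ler_nat; apply: eq_leq; apply: eq_bigl => y; rewrite inE.
Qed.

(** The quadratic bound gives [expR (1 / 2) <= 2]. *)
Lemma ln2_ge_half (R : realType) : 1 / 2 <= ln 2 :> R.
Proof.
rewrite -[leLHS]expRK ler_ln ?posrE ?expR_gt0 //.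
by have := @expR_le_quadratic R (1 / 2) (lexx _); lra.
Qed.

Lemma powR_expR_ln (R : realType) (a x : R) : 0 < a -> a `^ x = expR (x * ln a).
Proof. by move=> a0; rewrite /powR gt_eqF. Qed.

(** Every factor of size above 1 at least doubles the product, and [ln 2 >= 1 / 2]. *)
Lemma nontrivial_dims_le_ln (R : realType) k (d_ : 'I_k -> nat) :
  (forall i, 0 < d_ i)%N ->
  (\sum_i (1 < d_ i)%N)%N%:R <= 2 * ln (\prod_i d_ i)%N%:R :> R.
Proof.
move=> d0; set k' := (\sum_i _)%N.
have le2 : (2 ^ k' <= \prod_i d_ i)%N.
  by rewrite /k' expn_sum; apply: leq_prod => i _; have := d0 i;
    case: (ltnP 1 (d_ i)).
have n0 : (0 < \prod_i d_ i)%N by rewrite prodn_gt0.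
have : ln ((2 : R) ^+ k') <= ln (\prod_i d_ i)%N%:R.
  by rewrite ler_ln ?posrE ?exprn_gt0 ?ltr0n // -natrX ler_nat.
rewrite lnXn // -[ln 2 *+ _]mulr_natr.
have := ler_wpM2r (ler0n R k') (@ln2_ge_half R); lra.
Qed.

(** * Choice of the parameters *)

Section ChoiceOfRate.
Variables (R : realType) (d : nat) (eps : R).
Hypotheses (d2 : (2 <= d)%N) (eps0 : 0 < eps).

(* [theta] is large enough for [expR (- theta) <= eps / (16 d)]; the other two
   balance the [2 d] truncation losses against the total deviation allowed. *)
Definition theta := 12 * (ln d%:R * log_inv eps).
Definition lambda := eps / (36 * theta).
Definition rate := lambda ^+ 2 / (8 * d%:R).

Let d0R : 0 < d%:R :> R. Proof. by rewrite ltr0n; case: d d2. Qed.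

Let ln2_le_ln : ln 2 <= ln d%:R :> R.
Proof. by rewrite ler_ln ?posrE // ler_nat. Qed.

Let ln_ge_half : 1 / 2 <= ln d%:R :> R.
Proof. exact: le_trans (@ln2_ge_half R) ln2_le_ln. Qed.

Let log_inv_ge_half : 1 / 2 <= log_inv eps.
Proof. by rewrite /log_inv le_max ln2_ge_half. Qed.

Lemma theta_ge3 : 3 <= theta.
Proof. rewrite /theta; have := ln_ge_half; have := log_inv_ge_half; nra. Qed.

Lemma expR_theta_le : expR (- theta) <= eps / (16 * d%:R).
Proof.
have dn0 : d%:R != 0 :> R by rewrite gt_eqF.
have e0 : eps != 0 by rewrite gt_eqF.
have lnB : ln (1 / eps) <= log_inv eps by rewrite /log_inv le_max lexx orbT.
have -> : eps / (16 * d%:R) = expR (- (ln 2 *+ 4 + ln d%:R + ln (1 / eps))).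
  rewrite -lnXn // expRN !expRD !lnK ?posrE ?exprn_gt0 ?divr_gt0 //.
  by field; rewrite dn0 e0.
(* The 12 is 10 + 2: since both logarithms are at least 1/2, [4 ln 2 + ln d <= 5 ln d] costs 10
   times their product and [ln (1 / eps)] costs 2. *)
rewrite ler_expR lerN2 /theta -[ln 2 *+ 4]mulr_natr.
have := ln_ge_half; have := log_inv_ge_half; have := ln2_le_ln.
nra.
Qed.

(** [rate] is of order [eps^2 / (d ln^2 d log_inv^2 eps)]; the bound follows from [d <= d^(3/2)] and
    [ln d >= 1 / 2]. *)
Lemma rate_lower_bound :
  (16 * (36 * 12) ^+ 2)^-1 * (1 / (d%:R `^ (3 / 2) * ln d%:R ^+ 3)
     * (eps ^+ 2 / log_inv eps ^+ 2)) <= rate.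
Proof.
have dn0 : d%:R != 0 :> R by rewrite gt_eqF.
have A0 : 0 < ln d%:R :> R by have := ln_ge_half; lra.
have B0 : 0 < log_inv eps by have := log_inv_ge_half; lra.
have le_d : d%:R <= d%:R `^ (3 / 2) :> R.
  rewrite -{1}[d%:R]powRr1 ?ler0n // ler_powR //; last by lra.
  by rewrite ler1n; case: d d2.
have le_den : d%:R * (ln d%:R ^+ 2 / 2) <= d%:R `^ (3 / 2) * ln d%:R ^+ 3 :> R.
  apply: ler_pM => //.
    by rewrite divr_ge0 ?exprn_ge0 // ltW.
  rewrite [leRHS]exprSr ler_wpM2l ?exprn_ge0 ?(ltW A0) //.
  by have := ln_ge_half; lra.
have le_inv : 1 / (d%:R `^ (3 / 2) * ln d%:R ^+ 3)
    <= 1 / (d%:R * (ln d%:R ^+ 2 / 2)) :> R.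
  rewrite !div1r lef_pV2 ?posrE //.
    by rewrite mulr_gt0 ?exprn_gt0 ?powR_gt0.
  by rewrite mulr_gt0 ?divr_gt0 ?exprn_gt0.
have -> : rate = (16 * (36 * 12) ^+ 2)^-1 *
    (1 / (d%:R * (ln d%:R ^+ 2 / 2)) * (eps ^+ 2 / log_inv eps ^+ 2)).
  rewrite /rate /lambda /theta.
  move: (36 : R) (12 : R) (ltr0n R 36) (ltr0n R 12) => /= p q p0 q0.
  by field; rewrite dn0 !gt_eqF.
rewrite ler_wpM2l ?invr_ge0 // ler_wpM2r //.
by rewrite divr_ge0 // exprn_ge0 // ltW.
Qed.

Lemma lambda_gt0 : 0 < lambda.
Proof. by rewrite divr_gt0 // mulr_gt0 // (lt_le_trans _ theta_ge3). Qed.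

Lemma lambda_le_half : eps < 1 -> lambda <= 1 / 2.
Proof.
move=> e1; have := theta_ge3 => t3.
by rewrite ler_pdivrMr; [lra | rewrite mulr_gt0 //; lra].
Qed.

Lemma rate_gt0 : 0 < rate.
Proof. by rewrite divr_gt0 ?exprn_gt0 ?lambda_gt0 ?mulr_gt0. Qed.

(** The hypothesis says [ln d <= rate * ln n], so [4 d <= d^3 <= n^(3 rate)]. Of the gain
    [n^(- 4 rate)] from truncation, [n^(- rate)] survives. *)
Lemma rank_bound (n : R) : 0 < n -> d%:R `^ (1 / rate) <= n ->
  (2 * d)%:R * (2 * (n * expR (- (4 * rate * ln n)))) <= n `^ (1 - rate).
Proof.
move=> n0; rewrite powR_expR_ln // -{1}[n]lnK ?posrE // ler_expR.
rewrite div1r [_^-1 * _]mulrC ler_pdivrMr ?rate_gt0 // => le_d.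
have le4 : 4 * d%:R <= expR (3 * rate * ln n) :> R.
  apply: (@le_trans _ _ (d%:R ^+ 3)).
    have : 2 <= d%:R :> R by rewrite ler_nat.
    by rewrite [_ ^+ 3]exprS => ?; rewrite mulrC ler_pM2l //; nra.
  rewrite -[d%:R]lnK ?posrE // -expRM_natl ler_expR; lra.
rewrite powR_expR_ln // natrM.
have -> : (1 - rate) * ln n = 3 * rate * ln n + (ln n - 4 * rate * ln n) by ring.
rewrite expRD [expR (_ - _)]expRD lnK ?posrE //.
have -> : 2 * d%:R * (2 * (n * expR (- (4 * rate * ln n)))) =
  4 * d%:R * (n * expR (- (4 * rate * ln n))) by ring.
by rewrite ler_wpM2r // mulr_ge0 ?expR_ge0 // ltW.
Qed.

(** The three terms of the exponent are at most 1/18, 1/4 and 4/9 of [eps * ln n], in total 3/4 of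
    it. *)
Lemma sparsity_bound (n k' : R) : 1 <= n -> 0 <= k' -> k' <= 2 * ln n ->
  n * expR ((2 * d)%:R * (2 * theta * (4 * rate * ln n) / lambda
                          + k' * expR (- theta)) + 8 * theta * lambda * k')
    <= n `^ (1 + eps).
Proof.
move=> n1 k0 k'n; have n0 : 0 < n by lra.
rewrite powR_expR_ln // [(1 + eps) * _]mulrDl mul1r [expR (ln n + _)]expRD.
rewrite lnK ?posrE // ler_pM2l // ler_expR.
have x0 := ln_ge0 n1.
have t0 : 0 < theta by apply: lt_le_trans theta_ge3; lra.
have dn0 : d%:R != 0 :> R by rewrite gt_eqF.
have -> : (2 * d)%:R * (2 * theta * (4 * rate * ln n) / lambda
    + k' * expR (- theta)) + 8 * theta * lambda * k' =
    eps * ln n / 18 + 2 * d%:R * k' * expR (- theta) + 8 / 36 * eps * k'.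
  have e0 : eps != 0 by rewrite gt_eqF.
  by rewrite natrM /rate /lambda; field; rewrite dn0 e0 gt_eqF.
have h1 : 2 * d%:R * k' * expR (- theta) <= eps * k' / 8.
  have -> : eps * k' / 8 = 2 * d%:R * k' * (eps / (16 * d%:R)) by field.
  by rewrite ler_wpM2l ?expR_theta_le // !mulr_ge0 // ltW.
have h2 := ler_wpM2l (ltW eps0) k'n.
have h3 := mulr_ge0 (ltW eps0) x0.
lra.
Qed.

End ChoiceOfRate.

Theorem theorem1p3 (R : realType) :
  exists2 c : R, 0 < c &
  forall (d : nat) (eps : R), (2 <= d)%N -> 0 < eps ->
  exists2 gamma : R,
    c * (1 / (d%:R `^ (3 / 2) * ln d%:R ^+ 3)
         * (eps ^+ 2 / log_inv eps ^+ 2)) <= gamma &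
    forall (F : fieldType) (k : nat) (d_ : 'I_k -> nat)
           (M : forall i, 'M[F]_(d_ i)),
      (forall i, (0 < d_ i <= d)%N) ->
      let n := (\prod_(i < k) d_ i)%N in
      d%:R `^ (1 / gamma) <= n%:R ->
      (rigidity (kronecker M) (n%:R `^ (1 - gamma))%:nng)%:R
        <= n%:R `^ (1 + eps).
Proof.
exists (16 * (36 * 12) ^+ 2)^-1; first by rewrite invr_gt0.
move=> d eps d2 eps0; exists (rate d eps); first exact: rate_lower_bound.
move=> F k d_ M dd n le_n.
have d0 i : (0 < d_ i)%N by have /andP[] := dd i.
have n0 : (0 < n)%N by rewrite prodn_gt0.
have n1R : 1 <= n%:R :> R by rewrite ler1n.
(* For [eps >= 1] the bound is at least [n^2], so [Z] can be the whole matrix; for [eps < 1] one has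
   [lambda <= 1 / 2], the range of the moment bound. *)
have [eps1|eps1] := leP 1 eps.
  apply: (@le_trans _ _ (n%:R `^ 2)); last by rewrite ler_powR //; lra.
  rewrite powR_mulrn ?ler0n // expr2.
  apply: (@le_trans _ _ (nnz (kronecker M))%:R).
    by rewrite ler_nat rigidity_le // subrr mxrank0 /= powR_ge0.
  apply: nnz_row_sparse => x; rewrite ler_nat -[leqRHS]card_ord.
  exact: max_card.
have la_range : 0 < lambda d eps <= 1 / 2.
  by rewrite lambda_gt0 //= lambda_le_half.
have th0 : 0 <= theta d eps by apply: le_trans (theta_ge3 _ d2); lra.
have [Z [rZ sZ]] :=
  kronecker_approx M (4 * rate d eps * ln n%:R) la_range th0 dd.
apply: (@le_trans _ _ (nnz Z)%:R).
  rewrite ler_nat rigidity_le //=; apply: le_trans rZ _.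
  by apply: rank_bound; rewrite ?ltr0n.
apply: le_trans (nnz_row_sparse sZ) _.
by apply: sparsity_bound => //; exact: nontrivial_dims_le_ln.
Qed.
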